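(* Let $A\in\mathbb{C}^{n\times n}$, let $F_\Omega\in\mathbb{C}^{n\times n}$ be self-adjoint positive definite, and for $j=1,\dots,N$ let $R_j$ be the $n_j\times n$ restriction matrices, $D_j$ the $n_j\times n_j$ partition of unity matrices, $B_j\in\mathbb{C}^{n_j\times n_j}$ the local matrices, and $F_{\Omega_j}\in\mathbb{C}^{n_j\times n_j}$ self-adjoint positive definite matrices, all as described in the context. Assume that for all $j=1,\dots,N$, all $\mathbf V\in\mathbb{C}^n$ and all $\mathbf W^j\in\mathbb{C}^{n_j}$ $$(D_jR_jA\mathbf V,\mathbf W^j)=(D_jB_jR_j\mathbf V,\mathbf W^j).$$ Suppose that there exists $\Lambda_0>0$ such that for all $\mathbf W^j\in\mathbb{C}^{n_j}$, $j=1,\dots,N$, $$\Bigl\lVert\sum_{j=1}^N R_j^T\mathbf W^j\Bigr\rVert_\Omega^2\le\Lambda_0\sum_{j=1}^N\lVert\mathbf W^j\rVert_{\Omega_j}^2,$$ and $\Lambda_1>0$ such that for all $\mathbf V\in\mathbb{C}^n$ $$\sum_{j=1}^N\lVert R_j\mathbf V\rVert_{\Omega_j}^2\le\Lambda_1\lVert\mathbf V\rVert_\Omega^2 .$$ For $j=1,\dots,N$, suppose also that there exist $C_{D,j},C_{DB,j}>0$ such that for all $\mathbf V^j,\mathbf W^j\in\mathbb{C}^{n_j}$ $$\lVert D_j\mathbf W^j\rVert_{\Omega_j}\le C_{D,j}\lVert\mathbf W^j\rVert_{\Omega_j},\qquad \lvert([D_j,B_j]\mathbf V^j,\mathbf W^j)\rvert\le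 C_{DB,j}\lVert\mathbf V^j\rVert_{\Omega_j}\lVert\mathbf W^j\rVert_{\Omega_j},$$ and that there exists $C_{\mathrm{stab},j}>0$ such that for all $\mathbf U^j\in\mathbb{C}^{n_j}$ $$\lVert\mathbf U^j\rVert_{\Omega_j}\le C_{\mathrm{stab},j}\max_{\mathbf W^j\in\mathbb{C}^{n_j}\setminus\{0\}}\frac{\lvert(B_j\mathbf U^j,\mathbf W^j)\rvert}{\lVert\mathbf W^j\rVert_{\Omega_j}} .$$ Then $$\max_{\mathbf V\in\mathbb{C}^n\setminus\{0\}}\frac{\lVert M^{-1}A\mathbf V\rVert_\Omega}{\lVert\mathbf V\rVert_\Omega}\le\sqrt{\Lambda_0\Lambda_1}\,\max_{j=1,\dots,N}\{C_{D,j}(C_{\mathrm{stab},j}C_{DB,j}+C_{D,j})\}.$$ If in addition, for $j=1,\dots,N$, for all $\mathbf V\in\mathbb{C}^n$ and $\mathbf W^j\in\mathbb{C}^{n_j}$ $$(D_jR_jF_\Omega\mathbf V,\mathbf W^j)=(D_jF_{\Omega_j}R_j\mathbf V,\mathbf W^j),$$ and there exists $C_{DF,j}>0$ such that for all $\mathbf V^j,\mathbf W^j\in\mathbb{C}^{n_j}$ $$\lvert([D_j,F_{\Omega_j}]\mathbf V^j,\mathbf W^j)\rvert\le C_{DF,j}\lVert\mathbf V^j\rVert_{\Omega_j}\lVert\mathbf W^j\rVert_{\Omega_j},$$ then $$\min_{\mathbf V\in\mathbb{C}^n\setminus\{0\}}\frac{\lvert(F_\Omega\mathbf V,M^{-1}A\mathbf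 V)\rvert}{\lVert\mathbf V\rVert_\Omega^2}\ge\frac1{\Lambda_0}-\Lambda_1\max_{j=1,\dots,N}\{C_{D,j}C_{\mathrm{stab},j}C_{DB,j}\}-\Lambda_1\max_{j=1,\dots,N}\{C_{DF,j}(C_{\mathrm{stab},j}C_{DB,j}+C_{D,j})\}.$$
   Context: The $n$ unknowns form a set $\mathcal N$ with $\#\mathcal N=n$, decomposed as $\mathcal N=\bigcup_{j=1}^N\mathcal N_j$ into possibly overlapping subsets with $\#\mathcal N_j=n_j$. The restriction matrix $R_j$ is the $n_j\times n$ Boolean matrix whose $(i,i')$ entry is $1$ if the $i$-th unknown of $\mathcal N_j$ is the $i'$-th unknown of $\mathcal N$, and $0$ otherwise; $R_j^T$ is the extension by zero matrix. The partition of unity matrices $D_j$ are $n_j\times n_j$ diagonal with real non-negative entries and satisfy $\sum_{j=1}^N R_j^TD_jR_j=I$. The matrices $A$ ($n\times n$) and $B_j$ ($n_j\times n_j$) are complex and not necessarily self-adjoint nor positive definite (each $B_j$ is invertible, which follows from the assumed inf-sup condition). The one-level SORAS preconditioner is $$M^{-1}:=\sum_{j=1}^N R_j^TD_jB_j^{-1}D_jR_j .$$ Notation: $(\mathbf V,\mathbf W):=\mathbf W^*\mathbf V$ is the Hermitian inner product; $\lVert\mathbf V\rVert_\Omega:=(F_\Omega\mathbf V,\mathbf V)^{1/2}$ for $\mathbf V\in\mathbb{C}^n$; $\lVert\mathbf V^j\rVert_{\Omega_j}:=(F_{\Omega_j}\mathbf V^j,\mathbf V^j)^{1/2}$ for $\mathbf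 V^j\in\mathbb{C}^{n_j}$; $[P,Q]:=PQ-QP$ is the commutator. *)

(* Defs.v *)
From HB Require Import structures.
From mathcomp Require Import all_boot all_order all_algebra.
From mathcomp Require Import complex.
From mathcomp Require Import sesquilinear spectral.
From mathcomp Require Import boolp classical_sets reals.

Set Implicit Arguments.
Unset Strict Implicit.
Unset Printing Implicit Defensive.

Import Order.TTheory GRing.Theory Num.Theory.
Local Open Scope ring_scope.
Local Open Scope sesquilinear_scope.
Local Open Scope complex_scope.

Section Extrema.
Variable R : realType.

(* Maximum and minimum in the sense of an attained bound, unlike [sup] and
   [inf], which are total and equal 0 on empty or unbounded sets. *)
Definition is_max (E : set R) (m : R) : Prop := E m /\ ubound E m.
Definition is_min (E : set R) (m : R) : Prop := E m /\ lbound E m.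

(* { f V | V in C^n \ {0} } *)
Definition nonzero_values n (f : 'cV[R[i]]_n -> R) : set R :=
  [set f V | V in [set V : 'cV[R[i]]_n | V != 0]]%classic.

End Extrema.

Section Hermitian.
Variable R : realType.

(* Linear in the first argument, antilinear in the second. *)
Definition hdot n (V W : 'cV[R[i]]_n) : R[i] := (W ^t* *m V) 0 0.

(* On [R[i]], [0 < z] means that z is real and positive. *)
Definition hpd n (F : 'M[R[i]]_n) : Prop :=
  F \is hermsymmx /\ (forall V : 'cV[R[i]]_n, V != 0 -> 0 < hdot (F *m V) V).

(* The real part loses nothing: (F V, V) is real when F is Hermitian. *)
Definition energy_norm n (F : 'M[R[i]]_n) (V : 'cV[R[i]]_n) : R :=
  Num.sqrt (complex.Re (hdot (F *m V) V)).

(* Modulus of a complex number, as an element of R. *)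
Definition cmod (z : R[i]) : R := complex.Re `|z|.

Definition commutator n (P Q : 'M[R[i]]_n) : 'M[R[i]]_n := P *m Q - Q *m P.

End Hermitian.

Section Decomposition.
Variable R : realType.
Variables (n N : nat) (nj : 'I_N -> nat).

(* The global unknowns are numbered by 'I_n; [dof j i] is the global number of
   the i-th unknown of the j-th subset, so that this subset is the image of
   [dof j] and has [nj j] elements by injectivity. *)
Definition overlapping_decomposition (dof : forall j, 'I_(nj j) -> 'I_n) : Prop :=
  (forall j, injective (dof j)) /\
  \bigcup_(j < N) (dof j @: [set: 'I_(nj j)]) = [set: 'I_n].

Definition restriction_mx m (f : 'I_m -> 'I_n) : 'M[R[i]]_(m, n) :=
  \matrix_(i < m, i' < n) (f i == i')%:R.

(* On [R[i]], [0 <= z] means that z is real and nonnegative. *)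
Definition partition_of_unity (Rj : forall j, 'M[R[i]]_(nj j, n))
    (D : forall j, 'M[R[i]]_(nj j)) : Prop :=
  [/\ forall j, is_diag_mx (D j),
      forall j (i : 'I_(nj j)), 0 <= D j i i
    & \sum_(j < N) (Rj j)^T *m D j *m Rj j = 1%:M].

Definition soras (Rj : forall j, 'M[R[i]]_(nj j, n))
    (D B : forall j, 'M[R[i]]_(nj j)) : 'M[R[i]]_n :=
  \sum_(j < N) (Rj j)^T *m D j *m invmx (B j) *m D j *m Rj j.

End Decomposition.

(* Main.v *)
(* The local identity turns M^-1 A V into the sum of R_j^T D_j U_j, where
   U_j = B_j^-1 D_j B_j R_j V = D_j R_j V + B_j^-1 [D_j, B_j] R_j V, and the
   inf-sup condition bounds the last term E_j by C_stab C_DB |R_j V|. The upper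
   bound follows from Lambda_0 and Lambda_1. For the lower bound,
   (F V, M^-1 A V) is the sum of
   |D_j R_j V|^2 + (F_j D_j R_j V, E_j) + ([D_j, F_j] R_j V, U_j);
   the partition of unity and Lambda_0 bound the squares below by
   |V|^2 / Lambda_0, and the other two terms are perturbations. Both extrema are
   attained because the quotients are homogeneous of degree 0, hence determined
   by their values on a compact unit sphere. *)
Require Import Defs.
From HB Require Import structures.
From mathcomp Require Import all_boot all_order all_algebra.
From mathcomp Require Import complex.
From mathcomp Require Import sesquilinear spectral.
From mathcomp Require Import boolp classical_sets reals.
From mathcomp Require Import topology normedtype derive realfun.
From mathcomp Require Import ring.

Import Order.TTheory GRing.Theory Num.Theory.
Import numFieldNormedType.Exports.
Local Open Scope ring_scope.
Local Open Scope complex_scope.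

(** * The sesquilinear pairing, the complex modulus and energy norms *)

Section HermitianForms.
Set Implicit Arguments.
Unset Strict Implicit.
Variable R : realType.
Local Open Scope sesquilinear_scope.

Lemma hdotE n (V W : 'cV[R[i]]_n) : hdot V W = \sum_i Num.conj (W i 0) * V i 0.
Proof. by rewrite /hdot mxE; apply: eq_bigr => i _; rewrite !mxE. Qed.

Lemma hdotDl n (U V W : 'cV[R[i]]_n) : hdot (U + V) W = hdot U W + hdot V W.
Proof. by rewrite /hdot mulmxDr mxE. Qed.

Lemma hdotNl n (V W : 'cV[R[i]]_n) : hdot (- V) W = - hdot V W.
Proof. by rewrite /hdot mulmxN mxE. Qed.

Lemma hdotZl n a (V W : 'cV[R[i]]_n) : hdot (a *: V) W = a * hdot V W.
Proof. by rewrite /hdot -scalemxAr mxE. Qed.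

Lemma conj_hdot n (V W : 'cV[R[i]]_n) : Num.conj (hdot V W) = hdot W V.
Proof.
rewrite !hdotE rmorph_sum; apply: eq_bigr => i _.
by rewrite rmorphM /= conjCK mulrC.
Qed.

Lemma hdotDr n (U V W : 'cV[R[i]]_n) : hdot U (V + W) = hdot U V + hdot U W.
Proof. by rewrite -conj_hdot hdotDl rmorphD /= !conj_hdot. Qed.

Lemma hdotNr n (V W : 'cV[R[i]]_n) : hdot V (- W) = - hdot V W.
Proof. by rewrite -conj_hdot hdotNl rmorphN /= conj_hdot. Qed.

Lemma hdotZr n a (V W : 'cV[R[i]]_n) : hdot V (a *: W) = Num.conj a * hdot V W.
Proof. by rewrite -conj_hdot hdotZl rmorphM /= conj_hdot. Qed.

Lemma hdot0r n (V : 'cV[R[i]]_n) : hdot V 0 = 0.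
Proof. by rewrite -[0](scale0r 0) hdotZr conjC0 mul0r. Qed.

Lemma hdot0l n (V : 'cV[R[i]]_n) : hdot 0 V = 0.
Proof. by rewrite -conj_hdot hdot0r conjC0. Qed.

Lemma hdot_sumr n I (r : seq I) (V : 'cV[R[i]]_n) (W : I -> 'cV[R[i]]_n) :
  hdot V (\sum_(j <- r) W j) = \sum_(j <- r) hdot V (W j).
Proof. exact: (big_morph _ (hdotDr V) (hdot0r V)). Qed.

Lemma hdot_adjoint m n (M : 'M[R[i]]_(m, n)) V W :
  hdot (M *m V) W = hdot V (M ^t* *m W).
Proof. by rewrite /hdot trmx_mul map_mxM mulmxA trmxCK. Qed.

Lemma hdot_adjointr m n (M : 'M[R[i]]_(m, n)) V W :
  hdot V (M *m W) = hdot (M ^t* *m V) W.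
Proof. by rewrite hdot_adjoint trmxCK. Qed.

(** Pairing with a unit vector reads off a coordinate. This turns identities tested against all W
    into equalities of vectors. *)
Lemma hdot_inj n (U V : 'cV[R[i]]_n) :
  (forall W, hdot U W = hdot V W) -> U = V.
Proof.
move=> UV; apply/matrixP => i j; rewrite ord1.
have hdot_delta (Z : 'cV[R[i]]_n) : hdot Z (delta_mx i 0) = Z i 0.
  rewrite hdotE (bigD1 i) //= mxE !eqxx conjC1 mul1r big1 ?addr0 // => k kNi.
  by rewrite mxE (negPf kNi) conjC0 mul0r.
by rewrite -!hdot_delta.
Qed.

Lemma cmodE (z : R[i]) : (cmod z)%:C = `|z|.
Proof. by rewrite /cmod normc_def. Qed.

Lemma cmod_ge0 (z : R[i]) : 0 <= cmod z.
Proof. by rewrite -ler0c cmodE. Qed.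

Lemma cmod0 : cmod (0 : R[i]) = 0.
Proof. by rewrite /cmod normr0. Qed.

Lemma cmodD (y z : R[i]) : cmod (y + z) <= cmod y + cmod z.
Proof. by rewrite -lecR rmorphD /= !cmodE ler_normD. Qed.

Lemma cmodM (y z : R[i]) : cmod (y * z) = cmod y * cmod z.
Proof. by apply: complexI; rewrite rmorphM /= !cmodE normrM. Qed.

Lemma cmod_sqr (z : R[i]) : (cmod z ^+ 2)%:C = z * Num.conj z.
Proof. by rewrite -normCK -cmodE !expr2 [LHS]rmorphM. Qed.

Lemma cmodN (z : R[i]) : cmod (- z) = cmod z.
Proof. by rewrite /cmod normrN. Qed.

Lemma cmod_real (x : R) : 0 <= x -> cmod x%:C = x.
Proof.
by move=> x0; apply: complexI; rewrite cmodE ger0_norm // ler0c.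
Qed.

Lemma cmod_sum I (r : seq I) (z : I -> R[i]) :
  cmod (\sum_(j <- r) z j) <= \sum_(j <- r) cmod (z j).
Proof.
elim/big_rec2: _ => [|j x y _ xy]; first by rewrite cmod0.
by apply: (le_trans (cmodD _ _)); rewrite lerD2l.
Qed.

Section EnergyNorm.
Variables (n : nat) (F : 'M[R[i]]_n).
Hypothesis F_hpd : hpd F.

Lemma energy_norm_ge0 V : 0 <= energy_norm F V.
Proof. exact: sqrtr_ge0. Qed.

Lemma energy_norm0 : energy_norm F 0 = 0.
Proof. by rewrite /energy_norm hdot0r sqrtr0. Qed.

Lemma hpd_ge0 V : 0 <= hdot (F *m V) V.
Proof.
have [->|V0] := eqVneq V 0; first by rewrite hdot0r.
by rewrite ltW // F_hpd.2.
Qed.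

(** Nonnegativity in [R[i]] includes a vanishing imaginary part, so taking the real part loses
    nothing. Real norms can thus be exchanged for complex pairings. *)
Lemma energy_norm_sqr V : (energy_norm F V ^+ 2)%:C = hdot (F *m V) V.
Proof.
have := hpd_ge0 V; rewrite lecE /= => /andP[/eqP Im0 Re0].
by rewrite sqr_sqrtr // [RHS]complexE Im0 mulr0 addr0.
Qed.

Lemma energy_norm_gt0 V : V != 0 -> 0 < energy_norm F V.
Proof. by move=> /F_hpd.2; rewrite ltcE => /andP[_ ?]; rewrite sqrtr_gt0. Qed.

Lemma energy_norm_eq0 V : energy_norm F V <= 0 -> V = 0.
Proof.
move=> V0; apply/eqP; case: (eqVneq V 0) => // /energy_norm_gt0.
by rewrite ltNge V0.
Qed.

Lemma hpd_adjoint : F ^t* = F.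
Proof. by have /is_hermitianmxP := F_hpd.1; rewrite expr0 scale1r. Qed.

Lemma conj_hpd U V : Num.conj (hdot (F *m U) V) = hdot (F *m V) U.
Proof. by rewrite conj_hdot hdot_adjoint hpd_adjoint. Qed.

Lemma energy_normZ a V : energy_norm F (a *: V) = cmod a * energy_norm F V.
Proof.
apply/eqP; rewrite -(eqrXn2 (n := 2)) ?mulr_ge0 ?cmod_ge0 ?energy_norm_ge0 //.
apply/eqP/complexI; rewrite exprMn [RHS]rmorphM /= (cmod_sqr a).
rewrite (energy_norm_sqr (a *: V)) (energy_norm_sqr V).
by rewrite -scalemxAr hdotZl hdotZr mulrA.
Qed.

(** With a = (F V, V), b = (F U, V) and c = (F U, U), the form at a U - b V equals a (a c - |b|^2).
    It is nonnegative and a > 0, so |b|^2 <= a c. *)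
Lemma energy_Cauchy_Schwarz U V :
  cmod (hdot (F *m U) V) <= energy_norm F U * energy_norm F V.
Proof.
have [->|V0] := eqVneq V 0; first by rewrite hdot0r cmod0 energy_norm0 mulr0.
have a0 := F_hpd.2 V V0.
rewrite -(ler_pXn2r (n := 2)) ?nnegrE ?mulr_ge0 ?cmod_ge0 ?energy_norm_ge0 //.
rewrite exprMn -lecR [X in _ <= X]rmorphM /= (cmod_sqr (hdot _ _)).
rewrite (energy_norm_sqr U) (energy_norm_sqr V).
set a := hdot (F *m V) V in a0 *; set b := hdot (F *m U) V.
have := hpd_ge0 (a *: U - b *: V).
rewrite mulmxBr -!scalemxAr hdotDl hdotNl !hdotZl !hdotDr !hdotNr !hdotZr.
rewrite -/a -/b -(conj_hpd U V) -/b (CrealP (gtr0_real a0)).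
set c := hdot (F *m U) U.
rewrite [b^* * a]mulrC subrr mulr0 subr0 [a * c]mulrC [b^* * b]mulrC.
by rewrite pmulr_rge0 // subr_ge0.
Qed.

(** After squaring, the real part of each of the two cross terms is bounded by Cauchy-Schwarz. *)
Lemma energy_normD U V :
  energy_norm F (U + V) <= energy_norm F U + energy_norm F V.
Proof.
rewrite -(ler_pXn2r (n := 2)) ?nnegrE ?addr_ge0 ?energy_norm_ge0 //.
have -> : energy_norm F (U + V) ^+ 2 =
    complex.Re (hdot (F *m (U + V)) (U + V)) by rewrite -energy_norm_sqr.
have ReC (z : R[i]) : complex.Re z <= cmod z.
  rewrite -lecR cmodE; apply: le_trans (normc_ge_Re z).
  by rewrite lecR ler_norm.
rewrite mulmxDr hdotDl !hdotDr -!energy_norm_sqr.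
have UV : complex.Re (hdot (F *m U) V) <= energy_norm F U * energy_norm F V.
  exact: le_trans (ReC _) (energy_Cauchy_Schwarz _ _).
have VU : complex.Re (hdot (F *m V) U) <= energy_norm F U * energy_norm F V.
  by rewrite mulrC; exact: le_trans (ReC _) (energy_Cauchy_Schwarz _ _).
rewrite sqrrD; move: UV VU.
case: (hdot (F *m U) V) => a b; case: (hdot (F *m V) U) => c d /= ac ca.
by rewrite mulr2n !addrA lerD2r -!addrA lerD2l lerD.
Qed.

End EnergyNorm.
End HermitianForms.

(** * Continuity and attainment of extrema of homogeneous quotients *)

Section AttainedExtrema.
Set Implicit Arguments.
Unset Strict Implicit.
Variable R : realType.
Local Open Scope classical_set_scope.

(** Continuity is split into real and imaginary parts so that every argument takes place in the
    topology of R. *)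
Definition ccontinuous (T : topologicalType) (f : T -> R[i]) :=
  continuous (fun x => complex.Re (f x)) /\
  continuous (fun x => complex.Im (f x)).

Section ContinuousOperations.
Variable T : topologicalType.
Implicit Types f g : T -> R[i].

Lemma ccontinuous_cst (z : R[i]) : ccontinuous (fun _ : T => z).
Proof. by split=> x; exact: cvg_cst. Qed.

Lemma ccontinuousD f g : ccontinuous f -> ccontinuous g ->
  ccontinuous (fun x => f x + g x).
Proof.
have ReD (y z : R[i]) : complex.Re (y + z) = complex.Re y + complex.Re z.
  by case: y z => [? ?] [].
have ImD (y z : R[i]) : complex.Im (y + z) = complex.Im y + complex.Im z.
  by case: y z => [? ?] [].
move=> [rf jf] [rg jg]; split=> x.
  by under eq_fun do rewrite ReD; apply: cvgD; [exact: rf|exact: rg].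
by under eq_fun do rewrite ImD; apply: cvgD; [exact: jf|exact: jg].
Qed.

Lemma ccontinuousM f g : ccontinuous f -> ccontinuous g ->
  ccontinuous (fun x => f x * g x).
Proof.
have ReM (y z : R[i]) : complex.Re (y * z) =
    complex.Re y * complex.Re z - complex.Im y * complex.Im z.
  by case: y z => [? ?] [].
have ImM (y z : R[i]) : complex.Im (y * z) =
    complex.Re y * complex.Im z + complex.Im y * complex.Re z.
  by case: y z => [? ?] [].
move=> [rf jf] [rg jg]; split=> x.
  under eq_fun do rewrite ReM.
  by apply: cvgB; apply: cvgM; [exact: rf|exact: rg|exact: jf|exact: jg].
under eq_fun do rewrite ImM.
by apply: cvgD; apply: cvgM; [exact: rf|exact: jg|exact: jf|exact: rg].
Qed.

Lemma ccontinuous_conj f : ccontinuous f ->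
  ccontinuous (fun x => Num.conj (f x)).
Proof.
have ReC (z : R[i]) : complex.Re (Num.conj z) = complex.Re z by case: z.
have ImC (z : R[i]) : complex.Im (Num.conj z) = - complex.Im z by case: z.
move=> [rf jf]; split=> x; first by under eq_fun do rewrite ReC; exact: rf.
by under eq_fun do rewrite ImC; apply: cvgN; exact: jf.
Qed.

Lemma ccontinuous_sum I (r : seq I) (f : I -> T -> R[i]) :
  (forall j, ccontinuous (f j)) -> ccontinuous (fun x => \sum_(j <- r) f j x).
Proof.
move=> cf; elim: r => [|j r IHr].
  by under eq_fun do rewrite big_nil; exact: ccontinuous_cst.
by under eq_fun do rewrite big_cons; exact: ccontinuousD.
Qed.

Lemma ccontinuous_cmod f : ccontinuous f -> continuous (fun x => cmod (f x)).
Proof.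
move=> [rf jf] x; rewrite /cmod; under eq_fun do rewrite normc_def /=.
apply: (@continuous_comp _ _ _
  (fun x => complex.Re (f x) ^+ 2 + complex.Im (f x) ^+ 2) Num.sqrt);
  last exact: sqrt_continuous.
by apply: cvgD; apply: cvgM; [exact: rf|exact: rf|exact: jf|exact: jf].
Qed.

Lemma ccontinuous_mulmx m n (M : 'M[R[i]]_(m, n)) (V : T -> 'cV[R[i]]_n) :
  (forall i, ccontinuous (fun x => V x i 0)) ->
  forall i, ccontinuous (fun x => (M *m V x) i 0).
Proof.
move=> cV i; under eq_fun do rewrite mxE.
by apply: ccontinuous_sum => j; apply: ccontinuousM => //; exact: ccontinuous_cst.
Qed.

Lemma ccontinuous_hdot n (V W : T -> 'cV[R[i]]_n) :
  (forall i, ccontinuous (fun x => V x i 0)) ->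
  (forall i, ccontinuous (fun x => W x i 0)) ->
  ccontinuous (fun x => hdot (V x) (W x)).
Proof.
move=> cV cW; under eq_fun do rewrite hdotE.
apply: ccontinuous_sum => i; apply: ccontinuousM => //.
exact: ccontinuous_conj.
Qed.

Lemma continuous_energy_norm n (F : 'M[R[i]]_n) (V : T -> 'cV[R[i]]_n) :
  (forall i, ccontinuous (fun x => V x i 0)) ->
  continuous (fun x => energy_norm F (V x)).
Proof.
move=> cV x; rewrite /energy_norm.
apply: (@continuous_comp _ _ _
  (fun x => complex.Re (hdot (F *m V x) (V x))) Num.sqrt);
  last exact: sqrt_continuous.
have [Re_cont _] := ccontinuous_hdot (ccontinuous_mulmx F cV) cV.
exact: Re_cont.
Qed.

End ContinuousOperations.

Section Extremum.
Variable n : nat.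
Hypothesis n_gt0 : (0 < n)%N.

(** The identification of R^(2n) with C^n: real parts first, imaginary parts second. It makes
    compactness of the real unit sphere available. *)
Definition realified (x : 'rV[R]_(n + n)) : 'cV[R[i]]_n :=
  \col_i (x 0 (lshift n i) +i* x 0 (rshift n i)).

Lemma realified_continuous i : ccontinuous (fun x => realified x i 0).
Proof.
by split=> x; under eq_fun do rewrite mxE /=; exact: coord_continuous.
Qed.

Lemma realified_surj V : exists x, realified x = V.
Proof.
exists (row_mx (\row_i complex.Re (V i 0)) (\row_i complex.Im (V i 0))).
apply/matrixP => i j; rewrite ord1 mxE row_mxEl row_mxEr !mxE.
by case: (V i 0).
Qed.

Lemma realified0 : realified 0 = 0.
Proof. by apply/matrixP => i j; rewrite !mxE. Qed.

Lemma realified_eq0 x : (realified x == 0) = (x == 0).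
Proof.
apply/eqP/eqP => [x0|->]; last exact: realified0.
apply/rowP => k; rewrite mxE.
by case: (split_ordP k) => i ->; have /matrixP/(_ i 0) := x0; rewrite !mxE => -[].
Qed.

Lemma realifiedZ a x : realified (a *: x) = a%:C *: realified x.
Proof. by apply/matrixP => i j; rewrite !mxE; simpc. Qed.

(* A positively homogeneous function of degree 0 takes all its values on the
   unit sphere, which is compact. *)
Lemma homogeneous_max_attained (f : 'cV[R[i]]_n -> R) :
  (forall a V, 0 < a -> f (a%:C *: V) = f V) ->
  (forall x, x != 0 -> {for x, continuous (fun y => f (realified y))}) ->
  exists m, is_max (nonzero_values f) m.
Proof.
move=> f_hom f_cont.
pose S := [set x : 'rV[R]_(n + n) | `|x| = 1].
have normalized (x : 'rV[R]_(n + n)) : x != 0 -> S (`|x|^-1 *: x).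
  by move=> x0; rewrite /S /= normrZ normfV normr_id mulVf // normr_eq0.
have S_neq0 x : S x -> x != 0.
  by move=> Sx; rewrite -normr_eq0 Sx oner_eq0.
(* The normalized all-ones vector lies on the sphere; it is nonzero because n > 0. *)
have S_nonempty : S !=set0.
  exists (`|const_mx 1 : 'rV[R]_(n + n)|^-1 *: const_mx 1); apply: normalized.
  apply/eqP => /rowP/(_ (lshift n (Ordinal n_gt0))).
  by rewrite !mxE; apply/eqP/oner_neq0.
have S_compact : compact S.
  apply: bounded_closed_compact.
    by exists 1; split => // M M1 x /= ->; exact: ltW.
  apply: (@preimage_closed _ _ (fun x : 'rV[R]_(n + n) => `|x|) [set 1]).
    by move=> x _; exact: norm_continuous.
  exact: closed_eq.
have S_cont : {within S, continuous (fun x => f (realified x))}.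
  by apply: continuous_in_subspaceT => x; rewrite inE => /S_neq0 /f_cont.
have [c cS c_max] := compact_EVT_max S_nonempty S_compact S_cont.
exists (f (realified c)); split.
  exists (realified c) => //=; rewrite realified_eq0.
  by apply: S_neq0; rewrite inE in cS.
(* Any nonzero V is rescaled onto the sphere by a positive real factor, which leaves f unchanged. *)
move=> _ [V V0 <-]; have [x xV] := realified_surj V.
have x0 : x != 0 by rewrite -realified_eq0 xV.
have a0 : 0 < `|x|^-1 by rewrite invr_gt0 normr_gt0.
rewrite -xV -(f_hom _ _ a0) -realifiedZ; apply: c_max.
by rewrite inE; exact: normalized.
Qed.

End Extremum.
End AttainedExtrema.

(** * Estimates on a single subdomain *)

Section LocalEstimates.
Set Implicit Arguments.
Unset Strict Implicit.
Variable R : realType.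
Variables (m : nat) (D B F : 'M[R[i]]_m) (CD CDB Cstab : R).
Hypothesis F_hpd : hpd F.
Hypothesis CDP : forall W, energy_norm F (D *m W) <= CD * energy_norm F W.
Hypothesis CDBP : forall V W, cmod (hdot (commutator D B *m V) W) <=
  CDB * energy_norm F V * energy_norm F W.
Hypothesis CD_gt0 : 0 < CD.
Hypothesis Cstab_gt0 : 0 < Cstab.
Hypothesis CstabP : forall U, exists2 s : R,
  is_max (nonzero_values (fun W => cmod (hdot (B *m U) W) / energy_norm F W)) s
  & energy_norm F U <= Cstab * s.

(** The inf-sup maximum is attained at some nonzero W, where the assumed bound makes the quotient at
    most c. *)
Lemma inf_sup_bound c U :
  (forall W, cmod (hdot (B *m U) W) <= c * energy_norm F W) ->
  energy_norm F U <= Cstab * c.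
Proof.
move=> BU; have [s [[W W0 <-] _] Us] := CstabP U.
apply: (le_trans Us); rewrite ler_pM2l // ler_pdivrMr ?BU //.
exact: energy_norm_gt0.
Qed.

(** A kernel vector of B pairs to zero with every W, so the inf-sup bound with c = 0 makes its norm
    vanish. A square matrix with trivial kernel is invertible. *)
Lemma inf_sup_unitmx : B \in unitmx.
Proof.
rewrite -unitmx_tr -row_free_unit -kermx_eq0; apply/eqP/row_matrixP => k.
rewrite row0; apply: trmx_inj; rewrite trmx0.
apply: (energy_norm_eq0 F_hpd); rewrite -(mulr0 Cstab).
apply: inf_sup_bound => W.
suff -> : B *m (row k (kermx B^T))^T = 0 by rewrite hdot0l cmod0 mul0r.
by apply: trmx_inj; rewrite trmx_mul trmxK -row_mul mulmx_ker row0 trmx0.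
Qed.

(* B^-1 D B = D + B^-1 [D, B], and the inf-sup condition bounds the last term. *)
Lemma local_conjugation_error V :
  energy_norm F (invmx B *m (D *m B *m V) - D *m V) <=
  Cstab * CDB * energy_norm F V.
Proof.
rewrite -mulrA; apply: inf_sup_bound => W; apply: le_trans (CDBP V W).
rewrite mulmxBr mulKVmx ?inf_sup_unitmx // mulmxA -mulmxBl.
exact: lexx.
Qed.

(** Triangle inequality around D V: the conjugation error contributes [Cstab * CDB], and D V itself
    contributes [CD]. *)
Lemma local_conjugation_norm V :
  energy_norm F (invmx B *m (D *m B *m V)) <=
  (Cstab * CDB + CD) * energy_norm F V.
Proof.
rewrite -[X in energy_norm F X](subrK (D *m V)).
apply: (le_trans (energy_normD F_hpd _ _)).
by rewrite mulrDl lerD // local_conjugation_error.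
Qed.

(** Applied to R_j V, this controls one summand of M^-1 A V before its extension by zero; the outer
    D costs one more factor [CD]. *)
Lemma local_soras_norm V :
  energy_norm F (D *m (invmx B *m (D *m B *m V))) <=
  CD * (Cstab * CDB + CD) * energy_norm F V.
Proof.
apply: (le_trans (CDP _)); rewrite -mulrA ler_pM2l //.
exact: local_conjugation_norm.
Qed.

(** Write D F = F D + [D, F]. In (F D V, U), replacing U by D V gives the square, with remainder (F
    D V, U - D V) bounded by Cauchy-Schwarz and the conjugation error. The commutator term is
    bounded by [CDF] and the norm of U. *)
Lemma local_energy_expansion CDF V U :
  U = invmx B *m (D *m B *m V) ->
  0 < CDF ->
  (forall V W, cmod (hdot (commutator D F *m V) W) <=
    CDF * energy_norm F V * energy_norm F W) ->
  cmod (hdot (D *m F *m V) U - (energy_norm F (D *m V) ^+ 2)%:C) <=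
  (CD * Cstab * CDB + CDF * (Cstab * CDB + CD)) * energy_norm F V ^+ 2.
Proof.
move=> UE CDF_gt0 CDFP.
have -> : hdot (D *m F *m V) U - (energy_norm F (D *m V) ^+ 2)%:C =
    hdot (F *m (D *m V)) (U - D *m V) + hdot (commutator D F *m V) U.
  rewrite (energy_norm_sqr F_hpd (D *m V)) hdotDr hdotNr addrAC; congr (_ - _).
  by rewrite -hdotDl mulmxA -mulmxDl addrC subrK.
apply: (le_trans (cmodD _ _)); rewrite mulrDl expr2; apply: lerD.
  apply: (le_trans (energy_Cauchy_Schwarz F_hpd _ _)).
  have -> : CD * Cstab * CDB * (energy_norm F V * energy_norm F V) =
      (CD * energy_norm F V) * (Cstab * CDB * energy_norm F V).
    by ring.
  by apply: ler_pM; rewrite ?energy_norm_ge0 // UE local_conjugation_error.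
apply: (le_trans (CDFP _ _)).
rewrite -!mulrA ler_pM2l // [in leRHS]mulrCA ler_wpM2l ?energy_norm_ge0 //.
by rewrite UE local_conjugation_norm.
Qed.

End LocalEstimates.

(** * Assembly of the local estimates into the global bounds *)

Theorem theorem3p1 (R : realType) (n N : nat) (nj : 'I_N -> nat)
  (dof : forall j : 'I_N, 'I_(nj j) -> 'I_n)
  (Rj : forall j : 'I_N, 'M[R[i]]_(nj j, n))
  (D B FOj : forall j : 'I_N, 'M[R[i]]_(nj j))
  (A FO : 'M[R[i]]_n)
  (Lambda0 Lambda1 : R) (CD CDB Cstab : 'I_N -> R)
  (n_gt0 : (0 < n)%N)
  (dof_decomp : overlapping_decomposition dof)
  (RjE : forall j, Rj j = restriction_mx R (dof j))
  (D_pu : partition_of_unity Rj D)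
  (FO_hpd : hpd FO)
  (FOj_hpd : forall j, hpd (FOj j))
  (A_local : forall j (V : 'cV[R[i]]_n) (W : 'cV[R[i]]_(nj j)),
     hdot (D j *m Rj j *m A *m V) W = hdot (D j *m B j *m Rj j *m V) W)
  (Lambda0_gt0 : 0 < Lambda0)
  (Lambda0P : forall W : (forall j : 'I_N, 'cV[R[i]]_(nj j)),
     energy_norm FO (\sum_(j < N) (Rj j)^T *m W j) ^+ 2
       <= Lambda0 * \sum_(j < N) energy_norm (FOj j) (W j) ^+ 2)
  (Lambda1_gt0 : 0 < Lambda1)
  (Lambda1P : forall V : 'cV[R[i]]_n,
     \sum_(j < N) energy_norm (FOj j) (Rj j *m V) ^+ 2
       <= Lambda1 * energy_norm FO V ^+ 2)
  (CD_gt0 : forall j, 0 < CD j)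
  (CDP : forall j (W : 'cV[R[i]]_(nj j)),
     energy_norm (FOj j) (D j *m W) <= CD j * energy_norm (FOj j) W)
  (CDB_gt0 : forall j, 0 < CDB j)
  (CDBP : forall j (V W : 'cV[R[i]]_(nj j)),
     cmod (hdot (commutator (D j) (B j) *m V) W)
       <= CDB j * energy_norm (FOj j) V * energy_norm (FOj j) W)
  (Cstab_gt0 : forall j, 0 < Cstab j)
  (CstabP : forall j (U : 'cV[R[i]]_(nj j)),
     exists2 m : R,
       is_max (nonzero_values (fun W : 'cV[R[i]]_(nj j) =>
                 cmod (hdot (B j *m U) W) / energy_norm (FOj j) W)) m
       & energy_norm (FOj j) U <= Cstab j * m) :
  (exists2 m : R,
     is_max (nonzero_values (fun V : 'cV[R[i]]_n =>
               energy_norm FO (soras Rj D B *m A *m V) / energy_norm FO V)) m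
     & m <= Num.sqrt (Lambda0 * Lambda1)
            * \big[Num.max/0]_(j < N) (CD j * (Cstab j * CDB j + CD j)))
  /\
  (forall CDF : 'I_N -> R,
     (forall j (V : 'cV[R[i]]_n) (W : 'cV[R[i]]_(nj j)),
        hdot (D j *m Rj j *m FO *m V) W = hdot (D j *m FOj j *m Rj j *m V) W) ->
     (forall j, 0 < CDF j) ->
     (forall j (V W : 'cV[R[i]]_(nj j)),
        cmod (hdot (commutator (D j) (FOj j) *m V) W)
          <= CDF j * energy_norm (FOj j) V * energy_norm (FOj j) W) ->
     exists2 m : R,
       is_min (nonzero_values (fun V : 'cV[R[i]]_n =>
                 cmod (hdot (FO *m V) (soras Rj D B *m A *m V))
                   / energy_norm FO V ^+ 2)) m
       & Lambda0^-1
           - Lambda1 * \big[Num.max/0]_(j < N) (CD j * Cstab j * CDB j)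
           - Lambda1 * \big[Num.max/0]_(j < N)
                         (CDF j * (Cstab j * CDB j + CD j)) <= m).
Proof.
have [D_diag D_ge0 pu] := D_pu.
pose U (V : 'cV[R[i]]_n) j := invmx (B j) *m (D j *m B j *m (Rj j *m V)).
have sorasE (V : 'cV[R[i]]_n) :
  soras Rj D B *m A *m V = \sum_(j < N) (Rj j)^T *m (D j *m U V j).
  rewrite /soras !mulmx_suml; apply: eq_bigr => j _; rewrite -!mulmxA.
  (* Stripping R_j^T, D_j and B_j^-1 leaves D_j R_j A V = D_j B_j R_j V, which is the local identity
     tested against all W. *)
  congr (_ *m (_ *m (_ *m _))); rewrite !mulmxA.
  by apply: hdot_inj => W; rewrite A_local.
have Rj_adjoint j : map_mx Num.conj ((Rj j)^T)^T = Rj j.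
  by rewrite trmxK RjE; apply/matrixP => i k; rewrite !mxE conjC_nat.
(* A diagonal matrix with nonnegative, hence real, entries is self-adjoint. *)
have D_adjoint j : map_mx Num.conj (D j)^T = D j.
  apply/matrixP => i k; rewrite !mxE.
  have [->|ki] := eqVneq k i; first exact/CrealP/ger0_real.
  have /is_diag_mxP Dj_diag := D_diag j.
  by rewrite !Dj_diag ?conjC0 // eq_sym.
have norm0 := energy_norm_ge0.
have FO_gt0 V (V0 : V != 0) := energy_norm_gt0 FO_hpd V0.
have FO_cont x (V : 'rV[R]_(n + n) -> 'cV[R[i]]_n) :
  (forall i, ccontinuous (fun x => V x i 0)) ->
  {for x, continuous (fun y => energy_norm FO (V y))}.
  by move=> /continuous_energy_norm; apply.
have le_sqrM (x y z : R) : 0 <= x -> x <= y * z -> x ^+ 2 <= y ^+ 2 * z ^+ 2.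
  move=> x0 xyz; rewrite -exprMn; apply: lerXn2r => //.
  exact: le_trans xyz.
have re_cont := @realified_continuous R n.
have le_max (G : 'I_N -> R) j : G j <= \big[Num.max/0]_(k < N) G k.
  exact: le_bigmax.
(* A weighted form of the [Lambda1] bound. The base value 0 makes the maximum of the weights
   nonnegative, so it can be factored out and multiplied through. *)
have sum_Rj V (G : 'I_N -> R) :
    \sum_(j < N) G j * energy_norm (FOj j) (Rj j *m V) ^+ 2 <=
    Lambda1 * \big[Num.max/0]_(k < N) G k * energy_norm FO V ^+ 2.
  have M0 : 0 <= \big[Num.max/0]_(k < N) G k by exact: bigmax_ge_id.
  apply: (@le_trans _ _ (\sum_(j < N) \big[Num.max/0]_(k < N) G k *
    energy_norm (FOj j) (Rj j *m V) ^+ 2)).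
    by apply: ler_sum => j _; rewrite ler_wpM2r ?sqr_ge0.
  by rewrite -mulr_sumr [Lambda1 * _]mulrC -mulrA ler_wpM2l.
split.

  (* The upper bound on the norm of M^-1 A *)
  have [|x x0|m m_max] := homogeneous_max_attained n_gt0 (f := fun V =>
    energy_norm FO (soras Rj D B *m A *m V) / energy_norm FO V).
  - move=> a V a0; rewrite -scalemxAr !energy_normZ // -mulf_div divff ?mul1r //.
    by rewrite cmod_real ?ltW // gt_eqF.
  - apply: continuousM; first exact: (FO_cont x
      (fun y => soras Rj D B *m A *m realified y) (ccontinuous_mulmx _ re_cont)).
    apply: continuousV; last exact: (FO_cont x _ re_cont).
    by rewrite gt_eqF // FO_gt0 // realified_eq0.
  exists m => //; have [[V V0 <-] _] := m_max.
  rewrite ler_pdivrMr ?FO_gt0 //.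
  set K := \big[Num.max/0]_(j < N) _.
  have K0 : 0 <= K by exact: bigmax_ge_id.
  have L0 : 0 <= Lambda0 * Lambda1 by rewrite ltW ?mulr_gt0.
  rewrite -(ler_pXn2r (n := 2)) ?nnegrE ?mulr_ge0 ?sqrtr_ge0 ?norm0 //.
  rewrite !exprMn (sqr_sqrtr L0) sorasE; apply: (le_trans (Lambda0P (fun j => D j *m U V j))).
  have -> : Lambda0 * Lambda1 * K ^+ 2 * energy_norm FO V ^+ 2 =
      Lambda0 * (K ^+ 2 * (Lambda1 * energy_norm FO V ^+ 2)) by ring.
  (* [Lambda0] has been spent on gluing the pieces D_j U_j. Each piece is at most K times the norm
     of R_j V, and [Lambda1] sums the squares of these norms. *)
  rewrite ler_pM2l //; apply: (@le_trans _ _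
    (\sum_(j < N) K ^+ 2 * energy_norm (FOj j) (Rj j *m V) ^+ 2)); last first.
    by rewrite -mulr_sumr ler_wpM2l ?sqr_ge0.
  apply: ler_sum => j _; apply: le_sqrM; first exact: norm0.
  apply: le_trans (local_soras_norm (FOj_hpd j) (CDP j) (CDBP j) (CD_gt0 j)
    (Cstab_gt0 j) (CstabP j) _) _.
  by rewrite ler_wpM2r ?norm0 // le_max.

(* The lower bound on (F V, M^-1 A V) *)
move=> CDF F_local CDF_gt0 CDFP.
(* The minimum is obtained as the opposite of the maximum of the negated quotient. *)
have [|x x0|m [[V V0 Vm] m_ub]] := homogeneous_max_attained n_gt0 (f := fun V =>
  - (cmod (hdot (FO *m V) (soras Rj D B *m A *m V)) / energy_norm FO V ^+ 2)).
- move=> a V a0; apply: congr1.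
  have ratio (p q : R) : a * (a * p) / (a * q) ^+ 2 = p / q ^+ 2.
    by rewrite mulrA -expr2 exprMn -mulf_div divff ?mul1r // expf_neq0 ?gt_eqF.
  rewrite -!scalemxAr hdotZl hdotZr !cmodM energy_normZ //.
  by rewrite conj_Creal ?ger0_real ?ler0c ?cmod_real ?ltW.
- apply: continuousN; apply: continuousM.
    apply: ccontinuous_cmod; apply: ccontinuous_hdot => i;
    exact: ccontinuous_mulmx.
  have FO_x := FO_cont x _ (re_cont).
  apply: continuousV; last by apply: continuousM; exact: FO_x.
  by rewrite gt_eqF // mulr_gt0 // FO_gt0 // realified_eq0.
exists (- m); first split.
- by exists V => //; rewrite -Vm opprK.
- by move=> _ [W W0 <-]; rewrite lerNl; apply: m_ub; exists W.
rewrite -Vm opprK ler_pdivlMr ?exprn_gt0 ?FO_gt0 //.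
(* Contribution of subdomain j: R_j^T and D_j move to the left argument as adjoints, and the
   compatibility of F_Omega with the local forms replaces D_j R_j F_Omega by D_j F_j R_j. *)
pose Z j := hdot (D j *m FOj j *m (Rj j *m V)) (U V j).
have -> : hdot (FO *m V) (soras Rj D B *m A *m V) = \sum_(j < N) Z j.
  rewrite sorasE hdot_sumr; apply: eq_bigr => j _.
  rewrite hdot_adjointr Rj_adjoint hdot_adjointr D_adjoint /Z !mulmxA.
  exact: F_local.
pose S := \sum_(j < N) energy_norm (FOj j) (D j *m (Rj j *m V)) ^+ 2.
(* The partition of unity writes V as the sum of the R_j^T D_j R_j V, to which the [Lambda0] bound
   applies. *)
have VS : energy_norm FO V ^+ 2 <= Lambda0 * S.
  have {1}-> : V = \sum_(j < N) (Rj j)^T *m (D j *m (Rj j *m V)).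
    by rewrite -[LHS]mul1mx -pu mulmx_suml; apply: eq_bigr => j _; rewrite -!mulmxA.
  exact: (Lambda0P (fun j => D j *m (Rj j *m V))).
(* S is the sum of the [Z j] minus the sum of their defects from the local squares; the moduli are
   then bounded by the triangle inequality. *)
have S_le : S <= cmod (\sum_(j < N) Z j) +
  \sum_(j < N) cmod (Z j - (energy_norm (FOj j) (D j *m (Rj j *m V)) ^+ 2)%:C).
  have S0 : 0 <= S by apply: sumr_ge0 => j _; rewrite sqr_ge0.
  rewrite -[leLHS](cmod_real S0).
  have -> : S%:C = \sum_(j < N) Z j - \sum_(j < N)
      (Z j - (energy_norm (FOj j) (D j *m (Rj j *m V)) ^+ 2)%:C).
    by rewrite sumrB opprB addrC subrK rmorph_sum.
  by apply: (le_trans (cmodD _ _)); rewrite cmodN lerD2l cmod_sum.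
have defect_le : \sum_(j < N)
    cmod (Z j - (energy_norm (FOj j) (D j *m (Rj j *m V)) ^+ 2)%:C) <=
    Lambda1 * \big[Num.max/0]_(j < N) (CD j * Cstab j * CDB j)
      * energy_norm FO V ^+ 2 +
    Lambda1 * \big[Num.max/0]_(j < N) (CDF j * (Cstab j * CDB j + CD j))
      * energy_norm FO V ^+ 2.
  (* The two parts of the local constant are summed separately, so each gets its own maximum. *)
  apply: le_trans (lerD (sum_Rj V _) (sum_Rj V _)); rewrite -big_split /=.
  apply: ler_sum => j _; rewrite -mulrDl.
  exact: (local_energy_expansion (FOj_hpd j) (CDP j) (CDBP j) (Cstab_gt0 j)
    (CstabP j) erefl (CDF_gt0 j) (CDFP j)).
(* With both perturbation terms moved to the right, |V|^2 / [Lambda0] remains on the left and is at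
   most S. *)
rewrite !mulrBl !lerBlDr -addrA; apply: (@le_trans _ _ S).
  by rewrite mulrC ler_pdivrMr // mulrC.
by apply: (le_trans S_le); rewrite lerD2l addrC.
Qed.
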